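(* Let $n\in\mathbb{N}$, with $n=2\nu$ if $n$ is even and $n=2\nu+1$ if $n$ is odd. A matrix $M\in\mathbb{R}^{n\times n}$ is an element of $A_n$ if and only if $$M=\mathcal{X}_n\begin{pmatrix}\mathcal{O}&\Psi\\ \Phi&\mathcal{O}_\nu\end{pmatrix}\mathcal{X}_n$$ for some $\Phi,\Psi\in\mathbb{R}^{\nu\times\nu}$ if $n=2\nu$ is even, and for some $\Phi\in\mathbb{R}^{\nu\times(\nu+1)}$, $\Psi\in\mathbb{R}^{(\nu+1)\times\nu}$ if $n=2\nu+1$ is odd, where the top left null matrix $\mathcal{O}$ has matching size.
   Context: $A_n$ is the space of matrices $M\in\mathbb{R}^{n\times n}$ with $M_{i,j}+M_{n+1-i,n+1-j}=0$ for all $i,j\in\{1,\dots,n\}$. $\mathcal{I}_\nu$ is the $\nu\times\nu$ unit matrix, $\mathcal{O}_\nu$ the $\nu\times\nu$ null matrix, $0_\nu\in\mathbb{R}^\nu$ the null (column) vector, $\mathcal{J}_\nu=(\delta_{i,\nu+1-j})_{i,j=1}^\nu$ (ones on the antidiagonal, zeros elsewhere), and $$\mathcal{X}_n=\frac1{\sqrt2}\begin{pmatrix}\mathcal{I}_\nu&\mathcal{J}_\nu\\ \mathcal{J}_\nu&-\mathcal{I}_\nu\end{pmatrix}\ (n=2\nu),\qquad \mathcal{X}_n=\begin{pmatrix}\frac1{\sqrt2}\mathcal{I}_\nu&0_\nu&\frac1{\sqrt2}\mathcal{J}_\nu\\ 0_\nu^T&1&0_\nu^T\\ \frac1{\sqrt2}\mathcal{J}_\nu&0_\nu&-\frac1{\sqrt2}\mathcal{I}_\nu\end{pmatrix}\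 (n=2\nu+1).$$ *)

(* Defs.v *)
From mathcomp Require Import all_boot all_order all_algebra.
From mathcomp Require Import reals.

Set Implicit Arguments.
Unset Strict Implicit.
Unset Printing Implicit Defensive.

Import Order.TTheory GRing.Theory Num.Theory.
Local Open Scope ring_scope.

(* Indices are 0-based: [rev_ord i] = n - 1 - i is the 1-based n + 1 - i. *)
Definition A_space (R : realType) (n : nat) : {pred 'M[R]_n} :=
  [pred M : 'M[R]_n |
    [forall i, forall j, M i j + M (rev_ord i) (rev_ord j) == 0]].
Arguments A_space : clear implicits.

Definition J_mx (R : realType) (nu : nat) : 'M[R]_nu :=
  \matrix_(i, j) (i == rev_ord j)%:R.

Definition X_even (R : realType) (nu : nat) : 'M[R]_(nu + nu) :=
  (Num.sqrt 2)^-1 *: block_mx 1%:M       (J_mx R nu)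
                              (J_mx R nu) (- 1%:M).

(* The 3 x 3 block matrix with row and column sizes nu, 1, nu; the first two
   rows and columns of blocks are grouped, so that it can be multiplied with
   block matrices of row and column sizes nu + 1, nu. *)
Definition X_odd (R : realType) (nu : nat) : 'M[R]_(nu + 1 + nu) :=
  let s : R := (Num.sqrt 2)^-1 in
  block_mx (block_mx (s *: 1%:M) (0 : 'cV_nu)
                     (0 : 'rV_nu) (1%:M : 'M_1))
           (col_mx (s *: J_mx R nu)
                   (0 : 'rV_nu))
           (row_mx (s *: J_mx R nu) (0 : 'cV_nu))
           (- (s *: 1%:M)).

(* Main.v *)
(* With J the exchange matrix of size n, M lies in A_n iff J M J = - M. The
   matrix X is an involution with X J X = D := diag(1, -1), so N := X M X
   satisfies D N D = - N, which says that its diagonal blocks vanish. *)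
Require Import Defs.
From mathcomp Require Import all_boot all_order all_algebra.
From mathcomp Require Import reals.
From mathcomp Require Import zify.

Set Implicit Arguments.
Unset Strict Implicit.
Unset Printing Implicit Defensive.

Import Order.TTheory GRing.Theory Num.Theory.
Local Open Scope ring_scope.

Section ExchangeMatrix.
Variable R : realType.

(** As an equation between natural numbers, the condition on the indices can be compared across
    block decompositions by linear arithmetic. *)
Lemma J_mxE n (i j : 'I_n) : J_mx R n i j = ((i + j)%N == n.-1)%:R.
Proof.
rewrite mxE; congr (_%:R); congr nat_of_bool.
rewrite -val_eqE /=; have := ltn_ord i; have := ltn_ord j; lia.
Qed.

Lemma J_mulmx n p (M : 'M[R]_(n, p)) i j :
  (J_mx R n *m M) i j = M (rev_ord i) j.
Proof.
rewrite mxE (bigD1 (rev_ord i)) //= big1 => [|k neq_k].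
  by rewrite mxE rev_ordK eqxx mul1r addr0.
by rewrite mxE -(inj_eq rev_ord_inj) rev_ordK eq_sym (negPf neq_k) mul0r.
Qed.

Lemma mulmx_J n p (M : 'M[R]_(p, n)) i j :
  (M *m J_mx R n) i j = M i (rev_ord j).
Proof.
rewrite mxE (bigD1 (rev_ord j)) //= big1 => [|k neq_k].
  by rewrite mxE eqxx mulr1 addr0.
by rewrite mxE (negPf neq_k) mulr0.
Qed.

Lemma J_mxK n : J_mx R n *m J_mx R n = 1%:M.
Proof. by apply/matrixP => i j; rewrite J_mulmx !mxE (inj_eq rev_ord_inj). Qed.

Lemma A_spaceP n (M : 'M[R]_n) :
  M \in A_space R n <-> J_mx R n *m M *m J_mx R n = - M.
Proof.
split=> [/forallP AM | JMJ].
  apply/matrixP => i j; rewrite mulmx_J J_mulmx mxE; apply/eqP.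
  by have /forallP/(_ j) := AM i; rewrite addrC addr_eq0.
apply/forallP => i; apply/forallP => j.
by rewrite addrC addr_eq0 -J_mulmx -mulmx_J JMJ mxE.
Qed.

Lemma J_mx_even nu :
  J_mx R (nu + nu) = block_mx 0 (J_mx R nu) (J_mx R nu) 0.
Proof.
apply/matrixP => i j; rewrite J_mxE.
rewrite -[i]splitK -[j]splitK; case: (split i) => k; case: (split j) => l /=;
  rewrite ?(block_mxEul, block_mxEur, block_mxEdl, block_mxEdr) ?J_mxE ?mxE;
  have := ltn_ord k; have := ltn_ord l => ? ?;
  (* An entry of a zero block is read as [false%:R], so that both sides are images of booleans,
     which [lia] compares. *)
  try rewrite -[RHS]/(false%:R);
  congr (_%:R); congr nat_of_bool; lia.
Qed.

Lemma J_mx_odd nu :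
  J_mx R (nu + 1 + nu) =
  block_mx (block_mx 0 0 0 1%:M) (col_mx (J_mx R nu) 0)
           (row_mx (J_mx R nu) 0) 0.
Proof.
apply/matrixP => i j; rewrite J_mxE.
rewrite -[i]splitK -[j]splitK; case: (split i) => k; case: (split j) => l /=;
  rewrite ?(block_mxEul, block_mxEur, block_mxEdl, block_mxEdr);
  try (rewrite -[k]splitK; case: (split k) => {}k /=);
  try (rewrite -[l]splitK; case: (split l) => {}l /=);
  rewrite ?(block_mxEul, block_mxEur, block_mxEdl, block_mxEdr, row_mxEl,
            row_mxEr, col_mxEu, col_mxEd) ?J_mxE ?mxE ?ord1 /=;
  try have := ltn_ord k; try have := ltn_ord l; move=> *;
  try rewrite -[RHS]/(false%:R); try rewrite -[RHS]/(true%:R);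
  congr (_%:R); congr nat_of_bool; lia.
Qed.

End ExchangeMatrix.

Section BlockInvolution.
Variables (R : realType) (m1 m2 : nat).
Implicit Types (M X J : 'M[R]_(m1 + m2)).

Let D : 'M[R]_(m1 + m2) := block_mx 1%:M 0 0 (- 1%:M).

(** Conjugation by [D] fixes the two diagonal blocks and negates the other two, so only the diagonal
    blocks are constrained: each equals its own opposite. *)
Lemma antidiag_blockP M :
  D *m M *m D = - M <-> M = block_mx 0 (ursubmx M) (dlsubmx M) 0.
Proof.
rewrite -{1 2}[M]submxK opp_block_mx !mulmx_block.
rewrite !(mul0mx, mulmx0, add0r, addr0, mul1mx, mulmx1, mulNmx, mulmxN, opprK).
have self_opp p q (B : 'M[R]_(p, q)) : B = - B -> B = 0.
  move/eqP; rewrite -addr_eq0 -mulr2n -scaler_nat scaler_eq0 pnatr_eq0 /=.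
  by move/eqP.
split=> [/eq_block_mx [ul0 _ _ dr0] | ->].
  by rewrite -{1}[M]submxK (self_opp _ _ _ ul0) (self_opp _ _ _ dr0).
by rewrite block_mxKul block_mxKur block_mxKdl block_mxKdr !oppr0.
Qed.

Lemma conj_antidiagP X J M : X *m X = 1%:M -> J *m X = X *m D ->
  X *m J = D *m X ->
  J *m M *m J = - M <->
  exists (Phi : 'M_(m2, m1)) (Psi : 'M_(m1, m2)),
    M = X *m block_mx 0 Psi Phi 0 *m X.
Proof.
move=> XX JX XJ.
split=> [JMJ | [Phi [Psi ->]]].
  have /antidiag_blockP eqN : D *m (X *m M *m X) *m D = - (X *m M *m X).
    rewrite -mulNmx -mulmxN -JMJ mulmxA (mulmxA D) -XJ.
    by rewrite -(mulmxA _ X D) -JX !mulmxA.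
  (* The witnesses are the off-diagonal blocks of [N = X *m M *m X]; since [X] is an involution,
     [X *m N *m X] gives back [M]. *)
  exists (dlsubmx (X *m M *m X)), (ursubmx (X *m M *m X)).
  by rewrite -eqN !mulmxA XX mul1mx -mulmxA XX mulmx1.
set B := block_mx _ _ _ _.
(* Only the [B] on the right-hand side is replaced; both sides then become [X *m D *m B *m D *m X]
   once [J] is moved past [X]. *)
have {2}<- : - (D *m B *m D) = B.
  apply/eqP; rewrite eqr_oppLR; apply/eqP/antidiag_blockP.
  by rewrite /B block_mxKur block_mxKdl.
by rewrite mulmxN mulNmx opprK !mulmxA JX -!mulmxA XJ.
Qed.

Variables (s : R) (E : 'M[R]_m1) (K : 'M[R]_(m1, m2)) (K' : 'M[R]_(m2, m1)).
Hypotheses (s2 : s * s + s * s = 1) (K'K : K' *m K = 1%:M).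
Hypotheses (KK' : K *m K' = 1%:M - E) (EK : E *m K = 0) (K'E : K' *m E = 0).

(* The even case is E = 0, K = K' = J; in the odd case E is the projection on
   the middle coordinate. *)
Lemma block_conj_antidiagP M :
  let X := block_mx (s *: (1%:M - E) + E) (s *: K) (s *: K') (- (s *: 1%:M)) in
  let J := block_mx E K K' 0 in
  J *m M *m J = - M <->
  exists (Phi : 'M_(m2, m1)) (Psi : 'M_(m1, m2)),
    M = X *m block_mx 0 Psi Phi 0 *m X.
Proof.
move=> X J.
(* The factorization of [1%:M - E] through [K] and [K'] makes [E] and [1%:M - E] complementary
   projections, which yields the multiplication rules for all blocks. *)
have EQ : E *m (1%:M - E) = 0 by rewrite -KK' mulmxA EK mul0mx.
have QE : (1%:M - E) *m E = 0 by rewrite -KK' -mulmxA K'E mulmx0.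
have EE : E *m E = E.
  by apply/eqP; rewrite eq_sym -subr_eq0 -{1}[E]mulmx1 -mulmxBr EQ.
have QQ : (1%:M - E) *m (1%:M - E) = 1%:M - E.
  by rewrite {1}mulmxBl mul1mx EQ subr0.
have QK : (1%:M - E) *m K = K by rewrite mulmxBl mul1mx EK subr0.
have K'Q : K' *m (1%:M - E) = K' by rewrite mulmxBr mulmx1 K'E subr0.
have simp := (QK, K'Q, QQ, QE, EQ, EE, EK, K'E, KK', K'K, mul0mx, mulmx0,
  mul1mx, mulmx1, mulNmx, mulmxN, add0r, addr0, scaler0).
apply: conj_antidiagP; rewrite /X /J /D ?mulmx_block.
- rewrite [RHS]scalar_mx_block; congr block_mx.
  (* With [Q = 1 - E], this block of [X *m X] is [s^2 Q + E + s^2 Q = Q + E = 1]. *)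
  + rewrite !(mulmxDl (s *: _)) !(mulmxDr _ (s *: _)).
    rewrite -!scalemxAl -!scalemxAr QQ QE EQ EE KK' !scaler0 addr0 add0r.
    by rewrite !scalerA addrAC -scalerDl s2 scale1r subrK.
  + rewrite mulmxN mulmxDl -!scalemxAl -!scalemxAr QK EK scaler0 addr0 mulmx1.
    by rewrite scalerA subrr.
  + rewrite mulNmx mulmxDr -!scalemxAl -!scalemxAr K'Q K'E scaler0 addr0 mul1mx.
    by rewrite scalerA subrr.
  + rewrite mulmxN mulNmx opprK -!scalemxAl -!scalemxAr K'K mulmx1.
    by rewrite !scalerA -scalerDl s2 scale1r.
- congr block_mx; rewrite ?mulmxN ?mulmxDr -?scalemxAr ?simp ?subr0 ?opprK //.
  by rewrite addrC.
- congr block_mx; rewrite ?mulNmx ?mulmxDl -?scalemxAl ?simp ?subr0 ?opprK //.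
  by rewrite addrC.
Qed.

End BlockInvolution.

Theorem lemma5 (R : realType) (n nu : nat) (M : 'M[R]_n) :
  (forall e : (nu + nu)%N = n,
     M \in A_space R n <->
     exists (Phi : 'M[R]_(nu, nu)) (Psi : 'M[R]_(nu, nu)),
       M = castmx (e, e)
             (X_even R nu
                *m block_mx (0 : 'M[R]_nu) Psi
                            Phi            (0 : 'M[R]_nu)
                *m X_even R nu))
  /\
  (forall e : (nu + 1 + nu)%N = n,
     M \in A_space R n <->
     exists (Phi : 'M[R]_(nu, nu + 1)) (Psi : 'M[R]_(nu + 1, nu)),
       M = castmx (e, e)
             (X_odd R nu
                *m block_mx (0 : 'M[R]_(nu + 1)) Psi
                            Phi                  (0 : 'M[R]_nu)
                *m X_odd R nu)).
Proof.
have s2 : (Num.sqrt 2)^-1 * (Num.sqrt 2)^-1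
          + (Num.sqrt 2)^-1 * (Num.sqrt 2)^-1 = 1 :> R.
  rewrite -invfM -expr2 sqr_sqrtr ?ler0n // -mulr2n -[_^-1 *+ 2]mulr_natr mulVf //.
  by rewrite pnatr_eq0.
(* Eliminating [e] replaces [n] by the sum of block sizes, and the casts become identities. *)
split=> e; case: _ / e M => M; rewrite A_spaceP.
  rewrite J_mx_even (block_conj_antidiagP s2) ?J_mxK ?subr0 ?mul0mx ?mulmx0 //.
  by rewrite /X_even scale_block_mx scalerN addr0.
(* Here [K] is [J] with a zero row added and [K'] is [J] with a zero column added, so their product
   misses exactly the middle coordinate. *)
have KK' : col_mx (J_mx R nu) 0 *m row_mx (J_mx R nu) (0 : 'cV_nu) =
    1%:M - block_mx 0 0 0 1%:M.
  rewrite mul_col_row J_mxK !mul0mx mulmx0 scalar_mx_block opp_block_mx.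
  by rewrite add_block_mx !oppr0 !addr0 subrr.
rewrite J_mx_odd (block_conj_antidiagP s2 _ KK').
(* The block [s *: (1%:M - E) + E] is diagonal with entries [s, ..., s, 1], as in the top left of
   [X_odd]. *)
- rewrite /X_odd scalar_mx_block opp_block_mx add_block_mx !oppr0 !addr0 subrr.
  rewrite scale_block_mx add_block_mx !scaler0 !addr0 add0r.
  by rewrite scale_col_mx scale_row_mx !scaler0.
- by rewrite mul_row_col J_mxK mul0mx addr0.
- by rewrite mul_block_col !mul0mx mulmx0 !addr0 col_mx0.
- by rewrite mul_row_block !mul0mx !mulmx0 !addr0 row_mx0.
Qed.
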